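(* Let $X_1,X_2,\dots$ be independent, identically distributed random variables taking values in the positive integers, let $X$ denote a random variable with their common distribution, and assume $\gcd(\operatorname{Supp} X)=1$. Let $W_n=X_1+\dots+X_n$ for $n\ge 1$ (so, with $W_0=0$, the gaps $W_n-W_{n-1}=X_n$ are i.i.d.). If $\mathbb{E}[X^2]<\infty$, then with probability $1$ the sequence $\{W_n\}_{n\ge1}$ is asymptotically $2$-complete.
   Context: $\operatorname{Supp}X=\{x\in\mathbb{N}: P(X=x)>0\}$. An increasing sequence $\bar w=\{w_n\}_{n\ge1}$ of positive integers is called asymptotically $k$-complete if every sufficiently large integer can be written as the sum of exactly $k$ distinct elements of $\bar w$; i.e. there is $N$ such that every integer $m\ge N$ equals $w_{i_1}+\dots+w_{i_k}$ for some $i_1<\dots<i_k$. (The threshold $N$ may depend on the realization of the sequence.) *)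

(* Defs.v *)
From HB Require Import structures.
From mathcomp Require Import all_boot all_order all_algebra.
From mathcomp Require Import all_classical all_reals all_analysis.

Set Implicit Arguments.
Unset Strict Implicit.
Unset Printing Implicit Defensive.

Import Order.TTheory GRing.Theory Num.Theory.

Local Open Scope classical_set_scope.
Local Open Scope ring_scope.

Section random_variables.
Context {d d' : measure_display} {T : measurableType d}
  {T' : measurableType d'} {R : realType} (P : probability T R).

Definition mutually_independent (I : eqType) (X : I -> {RV P >-> T'}) : Prop :=
  forall (J : seq I) (A : I -> set T'), uniq J ->
    (forall i, measurable (A i)) ->
    (P (\big[setI/setT]_(i <- J) (X i @^-1` A i))
     = \prod_(i <- J) P (X i @^-1` A i))%E.

Definition same_distribution (X Y : {RV P >-> T'}) : Prop :=
  forall A : set T', measurable A -> distribution P X A = distribution P Y A.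

End random_variables.

(* nat carries its discrete sigma-algebra in MathComp-Analysis *)
Definition Supp (d : measure_display) (T : measurableType d) (R : realType)
    (P : probability T R) (X : {RV P >-> nat}) : set nat :=
  [set x | (0 < P [set t | X t = x])%E].

Definition is_gcd (A : set nat) (g : nat) : Prop :=
  (forall x, A x -> (g %| x)%N) /\
  (forall e : nat, (forall x, A x -> (e %| x)%N) -> (e %| g)%N).

(* Indices start at 0, so X i and w i are the informal X_{i+1} and w_{i+1};
   walk X n is W_n, with W_0 = 0. *)
Definition walk (T : Type) (X : nat -> T -> nat) (n : nat) (t : T) : nat :=
  (\sum_(i < n) X i t)%N.

(* Meant for strictly increasing w, for which distinct indices i_1 < ... < i_k
   (the entries of s) are the same as distinct elements of the sequence. *)
Definition asymptotically_complete (k : nat) (w : nat -> nat) : Prop :=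
  exists N : nat, forall m : nat, (N <= m)%N ->
    exists s : seq nat,
      [/\ size s = k, sorted ltn s & m = (\sum_(i <- s) w i)%N].

(* Main.v *)
(* By Borel-Cantelli and E[X^2] < oo, almost surely X_n^2 <= n for all large n,
   so up to time m all gaps are at most G = floor (sqrt m). Run the walk until it
   passes m / 2. From then on, within distance n0 + G of the current position
   there is always a site a = m - b, at distance at least n0, with b an already
   visited position, and hitting a represents m. The renewal probabilities
   u_n = P(n is visited) are bounded below by some c > 0 for n >= n0, so the walk
   misses each such site with probability at most 1 - c. It meets of order
   m / G ~ sqrt m of them before passing m, hence m is missed with probability
   at most (1 - c)^(const * sqrt m) = O(m^-2), and Borel-Cantelli concludes. *)

Require Import Defs.
From HB Require Import structures.
From mathcomp Require Import all_boot all_order all_algebra.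
From mathcomp Require Import all_classical all_reals all_analysis.
From mathcomp Require Import measurable_realfun.
From mathcomp Require Import zify ring lra.

Import Order.TTheory GRing.Theory Num.Theory.

Local Open Scope classical_set_scope.
Local Open Scope ring_scope.

(** * Cofiniteness of numerical semigroups *)

(** The least positive difference d of two elements of [S] divides every element, hence d = 1. With
    b > 0 and b + 1 in [S], any n >= b^2 is (q - r) b + r (b + 1), where q and r are the quotient
    and remainder of n by b. *)
Lemma semigroup_cofinite (S : set nat) :
  S 0%N -> (forall a b, S a -> S b -> S (a + b)%N) ->
  (forall e, (forall x, S x -> (e %| x)%N) -> (e %| 1)%N) ->
  exists N, forall n, (N <= n)%N -> S n.
Proof.
move=> S0 SD Sgcd.
have SM k a : S a -> S (k * a)%N.
  by move=> Sa; elim: k => [|k IH]; rewrite ?mul0n ?mulSn//; exact: SD.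
have [d [d0 [b [Sb Sbd]]] dmin] : exists2 d,
    (0 < d)%N /\ (exists b, S b /\ S (b + d)%N) &
    forall e, (0 < e < d)%N -> ~ exists b, S b /\ S (b + e)%N.
  have [x Sx x0] : exists2 x, S x & (0 < x)%N.
    apply: contrapT => nx; suff : (0 %| 1)%N by [].
    apply: Sgcd => x Sx; rewrite dvd0n; case: x Sx => // x Sx.
    by case: nx; exists x.+1.
  have : (0 < x)%N /\ exists b, S b /\ S (b + x)%N by split=> //; exists 0%N.
  elim/ltn_ind: x {Sx x0} => x IH [x0 hx].
  have [[e he]|ne] := pselect (exists e, (0 < e < x)%N /\
                                 exists b, S b /\ S (b + e)%N).
    by case: he => /andP[e0 ex] he; exact: (IH e).
  by exists x => // e he1 he2; apply: ne; exists e.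
have d1 : (d %| 1)%N.
  apply: Sgcd => x Sx; rewrite /dvdn -leqn0 leqNgt.
  apply/negP => r0; apply: (dmin (x %% d)%N); first by rewrite r0 ltn_pmod.
  (* For q = x / d, both q (b + d) and q b + x lie in [S], and they differ by x mod d. *)
  exists (x %/ d * (b + d))%N; split; first exact: SM.
  rewrite mulnDr -addnA -divn_eq; apply: SD => //; exact: SM.
move: d1; rewrite dvdn1 => /eqP d1; rewrite {}d1 in Sbd.
exists (b * b)%N => n nb.
have [b0|b0] := posnP b.
  by rewrite -(muln1 n); apply: SM; rewrite b0 in Sbd.
have qr : (n %% b <= n %/ b)%N.
  by rewrite (leq_trans (ltnW (ltn_pmod _ b0)))// leq_divRL.
rewrite (_ : n = (n %/ b - n %% b) * b + n %% b * (b + 1))%N.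
  by apply: SD; exact: SM.
rewrite [LHS](divn_eq n b) mulnBl mulnDr muln1.
by have := leq_mul qr (leqnn b); lia.
Qed.

(** * Renewal probabilities and their lower bound *)

Section renewal.
Context {R : realFieldType} (p : nat -> R).

(* The first argument is fuel; it is irrelevant once it is at least n. *)
Fixpoint renewal_rec (f n : nat) : R :=
  match n, f with
  | 0%N, _ => 1
  | n'.+1, f'.+1 => \sum_(j < n'.+1) renewal_rec f' j * p (n' - j).+1
  | _.+1, 0%N => 0
  end.

Definition renewal (n : nat) : R := renewal_rec n n.

Local Notation u := renewal.

Lemma renewal0 : u 0 = 1.
Proof. by []. Qed.

Lemma renewal_recE f n : (n <= f)%N -> renewal_rec f n = u n.
Proof.
rewrite /u; elim/ltn_ind: n f => -[|n] IH [|f]//= nf.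
apply: eq_bigr => j _; have jn := ltn_ord j; congr (_ * _).
by rewrite IH ?[RHS]IH//; lia.
Qed.

Lemma renewalS n : u n.+1 = \sum_(j < n.+1) u j * p (n - j).+1.
Proof. by rewrite {1}/u/=; apply: eq_bigr => j _; rewrite renewal_recE// -ltnS. Qed.

Context (p0 : p 0%N = 0) (p_ge0 : forall k, 0 <= p k).

(** Reversing the index conditions on the first gap, where [renewalS] conditions on the last. *)
Lemma renewal_step d : (0 < d)%N -> u d = \sum_(x < d.+1) p x * u (d - x).
Proof.
case: d => // d _; rewrite big_ord_recl p0 mul0r add0r renewalS.
rewrite (reindex_inj rev_ord_inj)/=; apply: eq_bigr => j _.
have jd := ltn_ord j; rewrite mulrC; congr (p _ * u _).
by rewrite /= /bump /=; lia.
Qed.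

Lemma renewal_ge0 n : 0 <= u n.
Proof.
elim/ltn_ind: n => -[|n] IH; first by rewrite renewal0.
by rewrite renewalS; apply: sumr_ge0 => j _; rewrite mulr_ge0// IH.
Qed.

(** Reaching a and then advancing by b reaches a + b: in the last-gap expansion of [u (a + b)], only
    last renewals at b or later are kept. *)
Lemma renewalD a b : u a * u b <= u (a + b)%N.
Proof.
elim/ltn_ind: a => -[|a] IH; first by rewrite renewal0 mul1r.
rewrite [u a.+1]renewalS mulr_suml addnC addnS renewalS -addnS big_split_ord/=.
rewrite ler_wpDl//; first by apply: sumr_ge0 => j _; rewrite mulr_ge0// renewal_ge0.
apply: ler_sum => j _; rewrite subnDl mulrAC ler_wpM2r//.
by rewrite addnC IH.
Qed.

Lemma le_renewal k : p k <= u k.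
Proof.
case: k => [|k]; first by rewrite p0 renewal0 ler01.
rewrite renewalS big_ord_recl/= renewal0 mul1r subn0 lerDl.
by apply: sumr_ge0 => j _; rewrite mulr_ge0// renewal_ge0.
Qed.

Lemma renewal_gt0 : (forall e, (forall x, 0 < p x -> (e %| x)%N) -> (e %| 1)%N) ->
  exists N, forall n, (N <= n)%N -> 0 < u n.
Proof.
move=> p_gcd; apply: (@semigroup_cofinite [set n | 0 < u n]) => /=.
- by rewrite renewal0.
- by move=> a b ua ub; rewrite (lt_le_trans _ (renewalD a b))// mulr_gt0.
- move=> e he; apply: p_gcd => x px; apply: he.
  exact: lt_le_trans (le_renewal x).
Qed.

(** The tail P(X > k): the chance that a renewal is followed by none in the next k steps. *)
Let r k := 1 - \sum_(j < k.+1) p j.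

(* Decomposition of the event that time n is reached according to the last renewal. *)
Lemma renewal_last n : \sum_(j < n.+1) u j * r (n - j) = 1.
Proof.
have r0 : r 0 = 1 by rewrite /r big_ord_recl big_ord0 p0 !addr0 subr0.
elim: n => [|n IH]; first by rewrite big_ord_recl big_ord0 addr0 renewal0 mul1r.
rewrite big_ord_recr/= subnn r0 mulr1 [u n.+1]renewalS -big_split/= -[RHS]IH.
apply: eq_bigr => j _; have jn := ltn_ord j.
rewrite -mulrDr; congr (_ * _).
by rewrite (_ : (n.+1 - j = (n - j).+1)%N) ?/r ?big_ord_recr/=; [ring|lia].
Qed.

Context (p_le1 : forall n, \sum_(j < n) p j <= 1).

Lemma renewal_le1 n : u n <= 1.
Proof.
have := renewal_last n; rewrite big_ord_recr/= subnn {2}/r.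
rewrite big_ord_recl big_ord0 p0 !addr0 subr0 mulr1 => <-.
by rewrite lerDr; apply: sumr_ge0 => j _; rewrite mulr_ge0 ?renewal_ge0// subr_ge0.
Qed.

(* By renewal_last, among any L consecutive values of u one is at least
   1 / (2 (L + 1)); u_a u_b <= u_(a+b) and aperiodicity spread this to all values. *)
Lemma renewal_lb (L : nat) :
  (forall e, (forall x, 0 < p x -> (e %| x)%N) -> (e %| 1)%N) ->
  (forall n, \sum_(j < n) r (L + j) <= 2^-1) ->
  exists2 c : R, 0 < c <= 1 & exists n0, forall n, (n0 <= n)%N -> c <= u n.
Proof.
move=> p_gcd p_mean; have [M uM] := renewal_gt0 p_gcd.
have [eta eta0 etaP] : exists2 eta, 0 < eta &
    forall k, (M <= k < M + L)%N -> eta <= u k.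
  elim: L {p_mean} => [|L [eta eta0 IH]].
    by exists 1 => // k; rewrite addn0 => /andP[Mk]; rewrite ltnNge Mk.
  exists (Num.min eta (u (M + L)%N)); first by rewrite lt_min eta0 uM// leq_addr.
  move=> k; rewrite addnS ltnS [(k <= _)%N]leq_eqVlt => /andP[Mk /orP[/eqP ->|kML]].
    by rewrite ge_min lexx orbT.
  by rewrite ge_min IH// Mk.
pose del : R := (2 * L.+1%:R)^-1.
have del0 : 0 < del by rewrite invr_gt0 mulr_gt0.
(* Otherwise [renewal_last] would give 1 <= L del + 1/2 < 1. *)
have window n : exists2 k, (k < L)%N & (k <= n)%N /\ del <= u (n - k).
  apply: contrapT => nw.
  have us k : (k < L)%N -> (k <= n)%N -> u (n - k) <= del.
    move=> kL kn; rewrite leNgt; apply/negP => /ltW dk; apply: nw; exists k => //.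
  have : \sum_(j < n.+1) u j * r (n - j) <= L%:R * del + 2^-1.
    (* [g k] dominates the term u (n - k) r k: for k < L because u <= del and r <= 1, beyond because
       u <= 1. *)
    pose g k := if (k < L)%N then del else r k.
    have r_ge0 k : 0 <= r k by rewrite subr_ge0.
    have g_ge0 k : 0 <= g k by rewrite /g; case: ifP => // _; exact: ltW.
    rewrite (reindex_inj rev_ord_inj)/=.
    have -> : L%:R * del + 2^-1 = \sum_(k < L) g k + 2^-1.
      rewrite (eq_bigr (fun=> del)) ?sumr_const ?card_ord ?mulr_natl// => k _.
      by rewrite /g ltn_ord.
    apply: (@le_trans _ _ (\sum_(k < L + n.+1) g k)); last first.
      rewrite big_split_ord/= lerD2l (le_trans _ (p_mean n.+1))//.
      by apply: ler_sum => k _; rewrite /g ltnNge leq_addr.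
    apply: (@le_trans _ _ (\sum_(k < n.+1) g k)); last first.
      by rewrite addnC big_split_ord/= lerDl sumr_ge0.
    apply: ler_sum => k _; have kn := ltn_ord k; rewrite subSS subKn// /g.
    case: ifPn => [kL|_]; last by rewrite ler_piMl// renewal_le1.
    rewrite (le_trans (ler_piMr _ _) (us _ kL _))// ?renewal_ge0//.
    by rewrite /r lerBlDr lerDl sumr_ge0.
  rewrite renewal_last; apply/negP; rewrite -ltNge.
  have : L%:R * del < 2^-1.
    by rewrite /del invfM mulrCA gtr_pMr ?invr_gt0// ltr_pdivrMr// mul1r ltr_nat.
  by lra.
exists (Num.min 1 (del * eta)).
  by rewrite lt_min ltr01 mulr_gt0//= ge_min lexx.
exists (M + L)%N => n Mn; rewrite ge_min; apply/orP; right.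
(* Starting from n - M leaves a remainder M + k in the range where [eta] bounds u from below. *)
have [k kL [kn dk]] := window (n - M)%N.
rewrite (_ : n = (n - M - k) + (M + k))%N; last by lia.
apply: le_trans (renewalD _ _); apply: ler_pM => //; try exact: ltW.
by apply: etaP; rewrite leq_addr ltn_add2l.
Qed.

End renewal.

(** * Positions of a walk with finitely many gaps *)

(** The list starts at W_1: the origin W_0 = 0 is not a term of the sequence. *)
Definition partial_sums (s : seq nat) : seq nat := scanl addn 0%N s.

Lemma partial_sums_rcons s x :
  partial_sums (rcons s x) = rcons (partial_sums s) (sumn s + x)%N.
Proof.
rewrite /partial_sums scanl_rcons; congr rcons; rewrite foldl_rcons; congr addn.
by elim/last_ind: s => //= s y IH; rewrite foldl_rcons sumn_rcons IH.
Qed.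

(** The last position not beyond t is within G of it. The bound G <= t ensures that the first
    position is not beyond t, as 0 is not listed. *)
Lemma partial_sums_dense G s t : (0 < G)%N -> all (leq^~ G) s ->
  (G <= t <= sumn s)%N -> exists2 b, b \in partial_sums s & (b <= t < b + G)%N.
Proof.
move=> G0; elim/last_ind: s => [|s x IH].
  by rewrite /= => _ /andP[Gt]; rewrite leqn0 => /eqP t0; rewrite t0 leqNgt G0 in Gt.
rewrite all_rcons sumn_rcons partial_sums_rcons => /andP[xG sG] /andP[Gt ts].
have [ts'|st] := leqP t (sumn s).
  have [b bs bt] := IH sG (introT andP (conj Gt ts')).
  by exists b => //; rewrite mem_rcons inE bs orbT.
have [->|tE] := eqVneq t (sumn s + x)%N.
  by exists (sumn s + x)%N; rewrite ?mem_rcons ?inE ?eqxx// leqnn; lia.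
case: (lastP s) IH sG ts tE st => [|s' y] IH sG ts tE st.
  by rewrite /= in ts tE; lia.
exists (sumn (rcons s' y)); last by lia.
by rewrite mem_rcons inE partial_sums_rcons mem_rcons inE sumn_rcons eqxx orbT.
Qed.

(** [pairwise] compares entries at different indices only, so a doubled position is not a forbidden
    sum. *)
Definition no_sum (m : nat) (s : seq nat) : bool :=
  pairwise (fun a b => a + b != m)%N (partial_sums s).

Lemma no_sum_rcons m s x : no_sum m (rcons s x) =
  all (fun b => b + (sumn s + x) != m)%N (partial_sums s) && no_sum m s.
Proof. by rewrite /no_sum partial_sums_rcons pairwise_rcons. Qed.

(** * Probability of avoiding a sum *)

Section avoid.
Context {R : realFieldType} (p : nat -> R).
Context (p0 : p 0%N = 0) (p_ge0 : forall k, 0 <= p k)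
        (p_le1 : forall n, \sum_(j < n) p j <= 1).

Local Notation u := (renewal p).

(** The probability, given first gaps [s], that the next n gaps are all at most G and no two
    positions sum to m, for independent gaps of law [p]. *)
Fixpoint avoid_weight (G m n : nat) (s : seq nat) : R :=
  if n is n'.+1 then \sum_(x < G.+1) p x * avoid_weight G m n' (rcons s x)
  else (no_sum m s)%:R.

Section fixed_target.
Context (G m : nat).

Local Notation aw := (avoid_weight G m).

Lemma avoid_weight_ge0 n s : 0 <= aw n s.
Proof. by elim: n s => //= n IH s; apply: sumr_ge0 => x _; rewrite mulr_ge0. Qed.

Lemma avoid_weight0 n s : ~~ no_sum m s -> aw n s = 0.
Proof.
elim: n s => [|n IH] s /= ms; first by rewrite (negbTE ms).
by rewrite big1// => x _; rewrite IH ?mulr0// no_sum_rcons negb_and ms orbT.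
Qed.

Lemma avoid_weightS_le n s (M : R) : 0 <= M ->
  (forall x, (0 < x <= G)%N -> aw n (rcons s x) <= M) -> aw n.+1 s <= M.
Proof.
move=> M0 sM; rewrite -[leRHS]mul1r (le_trans _ (ler_wpM2r M0 (p_le1 G.+1)))//=.
rewrite mulr_suml; apply: ler_sum => -[[|x] /= xG] _; first by rewrite p0 !mul0r.
by rewrite ler_wpM2l// sM.
Qed.

Lemma avoid_weight_le1 n s : aw n s <= 1.
Proof.
elim: n s => [|n IH] s; first by rewrite /=; case: no_sum.
exact: avoid_weightS_le.
Qed.

(* The walk reaches the site at distance d with probability u_d. *)
Lemma miss_weight d : (0 < d)%N ->
  \sum_(x < G.+1) p x * (1 - (if (x <= d)%N then u (d - x) else 0)) <= 1 - u d.
Proof.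
move=> d0; pose v x := if (x <= d)%N then u (d - x) else 0.
have v1 x : v x <= 1 by rewrite /v; case: ifP => // _; exact: renewal_le1.
have v_ge0 x : 0 <= v x by rewrite /v; case: ifP => // _; exact: renewal_ge0.
apply: (@le_trans _ _ (\sum_(x < d.+1 + G.+1) p x * (1 - v x))).
  rewrite addnC big_split_ord/= lerDl sumr_ge0// => x _.
  by rewrite mulr_ge0// subr_ge0.
under eq_bigr do rewrite mulrBr mulr1; rewrite sumrB lerB//.
rewrite renewal_step// big_split_ord/= ler_wpDr//.
  by apply: sumr_ge0 => x _; rewrite mulr_ge0.
by apply: ler_sum => x _; rewrite /v -ltnS ltn_ord.
Qed.

(** As b is already visited, landing on a makes the weight 0. An avoiding walk must therefore jump
    over a, into (a, a + G], where M bounds the rest; [miss_weight] carries the factor 1 - u through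
    each step. Gaps are positive, so a - [sumn s] gaps suffice. *)
Lemma avoid_weight_miss (a b N : nat) (M : R) : (b + a = m)%N -> 0 <= M ->
  (forall s n, all (leq^~ G) s -> b \in partial_sums s ->
    (a < sumn s <= a + G)%N -> (N <= n)%N -> aw n s <= M) ->
  forall s n, all (leq^~ G) s -> b \in partial_sums s -> (sumn s < a)%N ->
    (N + (a - sumn s) <= n)%N -> aw n s <= M * (1 - u (a - sumn s)).
Proof.
move=> bam M0 passM s; have [k] := ubnP (a - sumn s)%N.
elim: k s => // k IH s sk [|n] sG bs sa nN; first by exfalso; lia.
set d := (a - sumn s)%N in sk nN *.
have d0 : (0 < d)%N by rewrite subn_gt0.
rewrite (le_trans _ (ler_wpM2l M0 (miss_weight _ d0)))//= mulr_sumr.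
apply: ler_sum => -[[|x] /= xG] _; first by rewrite p0 !mul0r mulr0.
rewrite mulrCA ler_wpM2l//.
have sxG : all (leq^~ G) (rcons s x.+1) by rewrite all_rcons sG andbT.
have bsx : b \in partial_sums (rcons s x.+1).
  by rewrite partial_sums_rcons mem_rcons inE bs orbT.
have sumE := sumn_rcons s x.+1.
case: (ltngtP x.+1 d) => [xd|dx|xd].
- have := IH (rcons s x.+1) _ n sxG bsx; rewrite sumE.
  rewrite (_ : (a - (sumn s + x.+1) = d - x.+1)%N) ?/d; last by lia.
  by apply; lia.
- rewrite subr0 mulr1; apply: passM => //; rewrite ?sumE ?/d; lia.
- rewrite xd subnn renewal0 subrr mulr0 -xd avoid_weight0// no_sum_rcons negb_and.
  apply/orP; left; apply/negP => /allP /(_ _ bs) /eqP; apply.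
  by rewrite xd /d; lia.
Qed.

Context (c : R) (n0 : nat) (c_ge0 : 0 <= c) (c_le1 : c <= 1)
  (uc : forall n, (n0 <= n)%N -> c <= u n) (n0_gt0 : (0 < n0)%N) (G0 : (0 < G)%N).

(* Once the walk is past m / 2, its past is so dense that a site at distance
   between n0 and n0 + G completes a sum equal to m; each such site is missed
   with probability at most 1 - c. *)
Lemma avoid_weight_second_half k s n : all (leq^~ G) s -> (m <= 2 * sumn s)%N ->
  (sumn s + k * (n0 + 2 * G) <= m)%N -> (k * (n0 + 2 * G) <= n)%N ->
  aw n s <= (1 - c) ^+ k.
Proof.
elim: k s n => [|k IH] s n sG ms skm kn; first by rewrite expr0 avoid_weight_le1.
(* This choice puts the site m - b at a distance from n0 to less than n0 + G ahead of the current
   position. *)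
have [b bs /andP[bt tb]] : exists2 b, b \in partial_sums s &
    (b <= m - sumn s - n0 < b + G)%N.
  by apply: partial_sums_dense => //; lia.
have M0 : 0 <= (1 - c) ^+ k by rewrite exprn_ge0// subr_ge0.
have step : 1 - u (m - b - sumn s) <= 1 - c by rewrite lerB// uc//; lia.
rewrite exprSr (le_trans _ (ler_wpM2l M0 step))//.
(* One round covers less than n0 + G up to the site plus an overshoot of at most G, hence the length
   n0 + 2 G. *)
apply: (@avoid_weight_miss (m - b) b (k * (n0 + 2 * G))) => //; try lia.
by move=> s' n' s'G bs' s'a n'k; apply: IH => //; lia.
Qed.

(** Passing m / 2 takes at most [uphalf m] gaps and overshoots by at most G; the hypothesis leaves
    room for k rounds below m. *)
Lemma avoid_weight_le k : (uphalf m + G + k * (n0 + 2 * G) <= m)%N ->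
  aw m [::] <= (1 - c) ^+ k.
Proof.
move=> km; pose D := (n0 + 2 * G)%N.
suff gen l : forall s n, (uphalf m - sumn s <= l)%N -> all (leq^~ G) s ->
    (sumn s <= uphalf m + G)%N -> (k * D + (uphalf m - sumn s) <= n)%N ->
    aw n s <= (1 - c) ^+ k.
  by apply: (gen (uphalf m)) => //=; rewrite /D; lia.
elim: l => [|l IH] s n sl sG shG sn.
  by apply: avoid_weight_second_half => //; rewrite -/D; lia.
have [hs|sh] := leqP (uphalf m) (sumn s); first by apply: IH => //; lia.
case: n sn => [|n] sn; first by exfalso; lia.
apply: avoid_weightS_le; first by rewrite exprn_ge0// subr_ge0.
move=> x /andP[x0 xG]; apply: IH; rewrite ?sumn_rcons ?all_rcons ?xG//; lia.
Qed.

End fixed_target.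
End avoid.

(** * Quadratic decay in the target *)

(** Bernoulli gives c (j + 1) <= (1 + c)^j, and (1 - c) (1 + c) <= 1. Thus (1 - c)^j decays like 1 /
    j, which is all that is needed after a fourth power. *)
Lemma expr_bernoulli (R : realFieldType) (c : R) (j : nat) : 0 <= c <= 1 ->
  (1 - c) ^+ j * (c * j.+1%:R) <= 1.
Proof.
move=> /andP[c0 c1]; have c1' : 0 <= 1 - c by rewrite subr_ge0.
have cj : c * j.+1%:R <= (1 + c) ^+ j.
  elim: j => [|j IH]; first by rewrite mulr1 expr0.
  rewrite exprSr (_ : j.+2%:R = j.+1%:R + 1); last by rewrite -natr1.
  have j0 : 0 <= j%:R :> R by []; rewrite -natr1 in IH *.
  have : 1 <= (1 + c) ^+ j by rewrite exprn_ege1// lerDl.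
  by set e := _ ^+ j in IH *; set z := j%:R in j0 IH *; nra.
apply: le_trans (ler_wpM2l (exprn_ge0 j c1') cj) _.
by rewrite -exprMn exprn_ile1//; nra.
Qed.

Lemma nat_sqrtP m : exists G, (G * G <= m < G.+1 * G.+1)%N.
Proof.
elim: m => [|m [G /andP[Gm mG]]]; first by exists 0%N.
have [mG'|mG'] := ltnP m.+1 (G.+1 * G.+1); first by exists G; lia.
by exists G.+1; nia.
Qed.

Lemma avoid_weight_inv_square (R : realFieldType) (p : nat -> R) (c : R) (n0 : nat) :
  p 0%N = 0 -> (forall k, 0 <= p k) -> (forall n, \sum_(j < n) p j <= 1) ->
  0 < c <= 1 -> (forall n, (n0 <= n)%N -> c <= renewal p n) ->
  exists2 C : R, 0 <= C & forall m G, (G * G <= m < G.+1 * G.+1)%N ->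
    avoid_weight p G m m [::] <= C / m.+1%:R ^+ 2.
Proof.
move=> p0 p_ge0 p_le1 /andP[c0 c1] uc; pose g0 := (n0 + 100)%N.
have C1 : 0 <= c ^- 4 * 100 ^+ 4 by rewrite mulr_ge0 ?invr_ge0 ?exprn_ge0// ltW.
have C2 : 0 <= (g0 * g0)%:R ^+ 2 :> R by rewrite exprn_ge0.
exists (c ^- 4 * 100 ^+ 4 + (g0 * g0)%:R ^+ 2) => [|m G /andP[Gm mG]].
  by rewrite addr_ge0.
rewrite ler_pdivlMr ?exprn_gt0//.
(* For small G, the weight is at most 1 and m + 1 <= g0^2. *)
have [Gg|gG] := ltnP G g0.
  rewrite ler_wpDl// -[leRHS]mul1r ler_pM ?exprn_ge0 ?avoid_weight_ge0//.
    exact: avoid_weight_le1.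
  rewrite lerXn2r ?nnegrE// ler_nat; nia.
(* The 4 j rounds give decay j^-4, that is m^-2 since j is of order sqrt m. Dividing by 100 makes
   them fit: each has length at most 3 G, so together they cover at most 12 G^2 / 100. *)
rewrite ler_wpDr//; pose j := (G %/ 100)%N; pose K := (j * 4)%N.
have jG : (j * 100 <= G)%N by exact: leq_trunc_div.
have Gj : (G < j.+1 * 100)%N by exact: ltn_ceil.
have aK : avoid_weight p G m m [::] <= (1 - c) ^+ K.
  apply: (@avoid_weight_le _ _ p0 p_ge0 p_le1 _ _ _ n0.+1) => //.
  - exact: ltW.
  - by move=> n /ltnW; exact: uc.
  - by rewrite /g0 in gG; lia.
  - rewrite /g0 in gG; have : (K * (n0.+1 + 2 * G) * 25 <= G * (3 * G))%N.
      rewrite mulnAC; apply: leq_mul; rewrite /K; lia.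
    have : (100 * G <= G * G)%N by rewrite leq_mul2r; lia.
    by set Z := (K * _)%N; lia.
have mj : m.+1%:R ^+ 2 <= 100 ^+ 4 * j.+1%:R ^+ 4 :> R.
  rewrite -exprMn -natrM (exprM _ 2 2) lerXn2r ?nnegrE// ?exprn_ge0//.
  by rewrite -natrX ler_nat; nia.
have c1' : 0 <= 1 - c by rewrite subr_ge0.
apply: (@le_trans _ _ ((1 - c) ^+ K * (100 ^+ 4 * j.+1%:R ^+ 4))).
  by rewrite ler_pM ?avoid_weight_ge0 ?exprn_ge0.
have := @expr_bernoulli _ c j; rewrite (ltW c0) c1 => /(_ isT) B.
have B4 : ((1 - c) ^+ j * (c * j.+1%:R)) ^+ 4 <= 1.
  by rewrite exprn_ile1// !mulr_ge0// ?exprn_ge0// ltW.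
rewrite !exprMn -exprM -/K in B4; rewrite -[leRHS]mulr1.
apply: le_trans (ler_wpM2l C1 B4); rewrite le_eqVlt; apply/orP; left; apply/eqP.
by field; rewrite gt_eqF.
Qed.

(** * From random variables to weights of finite prefixes *)

Lemma sum_ltn_le n h : (\sum_(k < n) (k < h)%N <= h)%N.
Proof.
suff : (\sum_(k < n) (k < h)%N <= minn n h)%N by rewrite leq_min => /andP[].
elim: n => [|n IH]; first by rewrite big_ord0.
rewrite big_ord_recr; change (\sum_(k < n) (k < h) + (n < h) <= minn n.+1 h)%N.
by move: IH; case: (ltnP n h) => nh; lia.
Qed.

Section discrete_variables.
Context {R : realType} {d : measure_display} {T : measurableType d} (P : probability T R).

Lemma measurable_discrete (X : {RV P >-> nat}) (A : set nat) :
  measurable [set t | A (X t)].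
Proof. exact: (measurable_funPTI X). Qed.

(** Integrates the pointwise count of [sum_ltn_le]. With h x = x^2 it turns the second moment into a
    summable series. *)
Lemma sum_tail_le_integral (X : {RV P >-> nat}) (h : nat -> nat) (n : nat) :
  (\sum_(k < n) P [set t | (k < h (X t))%N] <= \int[P]_t ((h (X t))%:R : R)%:E)%E.
Proof.
have mA k : measurable [set t | (k < h (X t))%N].
  exact: (measurable_discrete X [set x | (k < h x)%N]).
have mh : measurable_fun setT (fun t => ((h (X t))%:R : R)).
  by move=> mT Y mY; rewrite setTI; exact: (measurable_discrete X [set x | Y (h x)%:R]).
under eq_bigr do rewrite -[X in P X]setIT -integral_indic//.
rewrite -ge0_integral_sum//; last first.
  by move=> k; exact/measurable_EFinP.
apply: ge0_le_integral => //.
- by move=> t _; apply: sume_ge0 => k _; rewrite lee_fin.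
- by apply: emeasurable_sum => k; exact/measurable_EFinP.
- exact/measurable_EFinP.
move=> t _; rewrite sumEFin lee_fin.
under eq_bigr do rewrite indicE mem_setE -topredE/=.
rewrite -natr_sum ler_nat.
exact: sum_ltn_le.
Qed.

Lemma nneseries_lty (f : nat -> \bar R) (M : R) : (forall k, 0 <= f k)%E ->
  (forall n, \sum_(k < n) f k <= M%:E)%E -> (\sum_(k <oo) f k < +oo)%E.
Proof.
move=> f0 fM; apply: le_lt_trans (ltry M); apply: lime_le.
  exact: is_cvg_nneseries.
by apply: nearW => n; rewrite /= big_mkord.
Qed.

Section iid.
Context (X_ : nat -> {RV P >-> nat}) (X : {RV P >-> nat}).
Context (X_indep : mutually_independent X_)
        (X_ident : forall n, same_distribution (X_ n) X).

Definition prefix_of (n : nat) (t : T) : seq nat := mkseq (fun i => X_ i t) n.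

Definition mass (k : nat) : R := fine (P [set t | X t = k]).

Lemma mass_ge0 k : 0 <= mass k.
Proof. by rewrite fine_ge0. Qed.

Lemma massE k : (mass k)%:E = P [set t | X t = k].
Proof.
rewrite fineK// fin_num_measure//; exact: (measurable_discrete X [set k]).
Qed.

Lemma sum_mass n : (\sum_(k < n) mass k)%:E = P [set t | (X t < n)%N].
Proof.
rewrite -sumEFin; under eq_bigr do rewrite massE.
rewrite -(@measure_semi_additive_ord_I _ _ _ P (fun k => [set t | X t = k])).
- congr (P _); rewrite -(bigcup_mkord n (fun k => [set t | X t = k])).
  apply/seteqP; split => t /=.
    by move=> [k /= kn ->].
  by move=> Xn; exists (X t).
- by move=> k _; exact: (measurable_discrete X [set k]).
- by move=> i j _ _ [t [/= <- <-]].
- by apply: bigsetU_measurable => k _; exact: (measurable_discrete X [set (k : nat)]).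
Qed.

Lemma sum_mass_le1 n : \sum_(k < n) mass k <= 1.
Proof.
rewrite -lee_fin sum_mass probability_le1//.
exact: (measurable_discrete X [set x | (x < n)%N]).
Qed.

Lemma tail_mass n : (1 - \sum_(k < n.+1) mass k)%:E = P [set t | (n < X t)%N].
Proof.
have -> : [set t | (n < X t)%N] = ~` [set t | (X t < n.+1)%N].
  by apply/seteqP; split => t /=; [move=> nX; apply/negP|move=> /negP]; lia.
rewrite probability_setC ?sum_mass//; last first.
  exact: (measurable_discrete X [set x | (x < n.+1)%N]).
by rewrite EFinB sum_mass.
Qed.

Lemma probability_ident n (A : set nat) :
  P [set t | A (X_ n t)] = P [set t | A (X t)].
Proof. by have := @X_ident n A; apply. Qed.

(** There are countably many lists, so the event is a countable union of cylinders. *)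
Lemma measurable_prefix n (Q : set (seq nat)) : measurable [set t | Q (prefix_of n t)].
Proof.
have mE s : measurable [set t | prefix_of n t = s].
  have [ns|ns] := eqVneq (size s) n; last first.
    rewrite (_ : [set _ | _] = set0)//; apply/seteqP; split => // t /= E.
    by case/eqP: ns; rewrite -E size_mkseq.
  rewrite (_ : [set _ | _] = \bigcap_(i in `I_n) [set t | X_ i t = nth 0%N s i]).
    apply: bigcap_measurableType => i _.
    exact: (measurable_discrete (X_ i) [set nth 0%N s i]).
  apply/seteqP; split => t /=.
    by move=> <- i /= iN; rewrite nth_mkseq.
  move=> H; apply: (@eq_from_nth _ 0%N); first by rewrite size_mkseq.
  by move=> i; rewrite size_mkseq => iN; rewrite nth_mkseq// H.
rewrite (_ : [set _ | _] = \bigcup_(s : seq nat)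
    ([set t | prefix_of n t = s] `&` [set t | Q s])).
  apply: countable_bigcupT_measurable => // s; apply: measurableI => //.
  have [q|q] := pselect (Q s).
    by rewrite (_ : [set _ | _] = setT)//; apply/seteqP; split.
  by rewrite (_ : [set _ | _] = set0)//; apply/seteqP; split.
apply/seteqP; split => t /=; first by move=> Qt; exists (prefix_of n t).
by move=> [s _ [/= -> ]].
Qed.

Lemma probability_prefix s :
  P [set t | prefix_of (size s) t = s] = (\prod_(x <- s) mass x)%:E.
Proof.
have := X_indep (iota 0 (size s)) (fun i => [set nth 0%N s i]) (iota_uniq _ _).
rewrite -bigcap_seq => /(_ (fun=> I)) H.
rewrite (_ : [set _ | _] =
    \bigcap_(i in [set` iota 0 (size s)]) X_ i @^-1` [set nth 0%N s i]).
  have iE : iota 0 (size s) = index_iota 0 (size s) by rewrite /index_iota subn0.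
  rewrite H iE big_mkord -prodEFin (big_nth 0%N) big_mkord.
  apply: eq_bigr => i _; rewrite massE; exact: (@probability_ident i [set nth 0%N s i]).
apply/seteqP; split => t /=.
  by move=> <- i /=; rewrite mem_iota size_mkseq => iN; rewrite nth_mkseq.
move=> H'; apply: (@eq_from_nth _ 0%N); first by rewrite size_mkseq.
by move=> i; rewrite size_mkseq => iN; rewrite nth_mkseq// H'//= mem_iota.
Qed.

(** Splitting on the gap after [s], at most G on this event, reproduces the recursion of
    [avoid_weight]; subadditivity suffices for the bound. *)
Lemma probability_no_sum_prefix G m n s :
  (P [set t | let l := prefix_of (size s + n) t in
       [/\ take (size s) l = s, all (leq^~ G) l & no_sum m l]] <=
   ((\prod_(x <- s) mass x) * avoid_weight mass G m n s)%:E)%E.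
Proof.
elim: n s => [|n IH] s.
  rewrite addn0 /=; case: (boolP (no_sum m s)) => ms; last first.
    rewrite mulr0 (_ : [set _ | _] = set0) ?measure0//.
    apply/seteqP; split => // t /= [+ _].
    by rewrite take_oversize ?size_mkseq// => ->; rewrite (negbTE ms).
  rewrite mulr1 -probability_prefix le_measure ?inE//.
  - exact: (@measurable_prefix _
      [set l | [/\ take _ l = s, all (leq^~ G) l & no_sum m l]]).
  - exact: (@measurable_prefix _ [set s]).
  - by move=> t /= [+ _ _]; rewrite take_oversize ?size_mkseq.
rewrite /= mulr_sumr -sumEFin.
pose F x := [set t | let l := prefix_of (size (rcons s x) + n) t in
  [/\ take (size (rcons s x)) l = rcons s x, all (leq^~ G) l & no_sum m l]].
have mF s' n' : measurable [set t | let l := prefix_of n' t in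
  [/\ take (size s') l = s', all (leq^~ G) l & no_sum m l]].
  exact: (@measurable_prefix _
    [set l | [/\ take _ l = s', all (leq^~ G) l & no_sum m l]]).
apply: (@le_trans _ _ (\sum_(x < G.+1) P (F x))%E).
  apply: content_subadditive => //; first by move=> x _; exact: mF.
  rewrite -bigcup_mkord => t /= [ts tG tm].
  have sl : (size s < size (prefix_of (size s + n.+1) t))%N by rewrite size_mkseq; lia.
  exists (nth 0%N (prefix_of (size s + n.+1) t) (size s)) => /=.
    by rewrite ltnS; apply: (allP tG); rewrite mem_nth.
  by rewrite /F /= size_rcons addSnnS (take_nth 0%N)// ts.
apply: lee_sum => x _.
rewrite mulrA (_ : _ * mass x = \prod_(y <- rcons s x) mass y) ?IH//.
by rewrite big_rcons.
Qed.

End iid.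
End discrete_variables.

(** * Summability and Borel-Cantelli *)

Lemma sum_inv_square_le {R : realFieldType} n :
  \sum_(k < n) (k.+1%:R ^- 2 : R) <= 2.
Proof.
case: n => [|n]; first by rewrite big_ord0.
(* The sharper bound telescopes: (x + 1)^-2 <= x^-1 - (x + 1)^-1. *)
suff : \sum_(k < n.+1) (k.+1%:R ^- 2 : R) <= 2 - n.+1%:R^-1.
  by move=> /le_trans; apply; rewrite gerBl.
elim: n => [|n IH]; first by rewrite big_ord_recl big_ord0 expr1n invr1; lra.
rewrite big_ord_recr/= -[n.+2%:R]natr1; apply: le_trans (lerD IH (lexx _)) _.
have : 0 < n.+1%:R :> R by [].
move: (n.+1%:R : R) => x x0; rewrite -subr_ge0.
have -> : 2 - (x + 1)^-1 - (2 - x^-1 + (x + 1) ^- 2) = x^-1 * (x + 1) ^- 2 :> R.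
  by field; rewrite !gt_eqF//; lra.
by rewrite mulr_ge0 ?invr_ge0 ?exprn_ge0//; lra.
Qed.

Lemma bounded_sum_tail {R : realType} (r : nat -> R) (M e : R) : (forall k, 0 <= r k) ->
  (forall n, \sum_(k < n) r k <= M) -> 0 < e ->
  exists L, forall n, \sum_(j < n) r (L + j)%N <= e.
Proof.
move=> r0 rM e0; pose E := [set \sum_(k < n) r k | n in [set: nat]].
have supE : has_sup E.
  by split; [exists (\sum_(k < 0) r k), 0%N | exists M => _ [n _ <-]].
have [_ [L _ <-] LE] := sup_adherent e0 supE.
exists L => n; have : \sum_(k < L + n) r k <= sup E.
  by apply: ub_le_sup; [exact: supE.2 | exists (L + n)%N].
by rewrite big_split_ord/=; move: LE; rewrite ltrBlDr; lra.
Qed.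

(** First Borel-Cantelli lemma: the limsup of the events is the null set. *)
Lemma ae_eventually_not {R : realType} {d : measure_display} {T : measurableType d}
    (P : probability T R) (F : nat -> set T) (M : R) :
  (forall k, measurable (F k)) -> (forall n, \sum_(k < n) P (F k) <= M%:E)%E ->
  {ae P, forall t, exists N, forall n, (N <= n)%N -> ~ F n t}.
Proof.
move=> mF FM; exists (lim_sup_set F); split.
- by apply: bigcap_measurableType => n _; exact: bigcup_measurable.
- by apply: lim_sup_set_cvg0 => //; apply: nneseries_lty FM.
- move=> t /= nt n _; apply: contrapT => nF; apply: nt; exists n => k nk Fk.
  by apply: nF; exists k.
Qed.

(** * Almost sure completeness *)

Lemma nth_partial_sums_prefix {R : realType} {d : measure_display} {T : measurableType d}
    (P : probability T R) (X_ : nat -> {RV P >-> nat}) n i t : (i < n)%N ->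
  nth 0%N (partial_sums (prefix_of P X_ n t)) i = walk X_ i.+1 t.
Proof.
have size_ps m : size (partial_sums (prefix_of P X_ m t)) = m.
  by rewrite size_scanl size_mkseq.
have sumE m : sumn (prefix_of P X_ m t) = walk X_ m t.
  rewrite /prefix_of /walk; elim: m => [|m IH]; first by rewrite big_ord0.
  by rewrite mkseqS sumn_rcons IH big_ord_recr.
elim: n => // n IH; rewrite ltnS /prefix_of mkseqS partial_sums_rcons nth_rcons.
rewrite -/(prefix_of P X_ n t) size_ps leq_eqVlt => /orP[/eqP ->|/[dup] iN ->].
  by rewrite ltnn eqxx sumE /walk big_ord_recr.
exact: IH.
Qed.

Theorem theorem1p3 (R : realType) (d : measure_display) (T : measurableType d)
    (P : probability T R) (X_ : nat -> {RV P >-> nat}) (X : {RV P >-> nat})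
    (X_pos : forall (n : nat) (t : T), (0 < X_ n t)%N)
    (X_indep : mutually_independent X_)
    (X_ident : forall n : nat, same_distribution (X_ n) X)
    (X_gcd : is_gcd (Supp X) 1%N)
    (X_sq : ('E_P[(fun t => (X t)%:R ^+ 2 : R)%R] < +oo)%E) :
  {ae P, forall t, asymptotically_complete 2%N (fun n => walk X_ n.+1 t)}.
Proof.
pose p := mass P X.
have p_ge0 : forall k, 0 <= p k := mass_ge0 P X.
have p_le1 : forall n, \sum_(j < n) p j <= 1 := sum_mass_le1 P X.
(* Positivity is assumed of the X_n and passes to the common law through X_0. *)
have p0 : p 0%N = 0.
  apply: EFin_inj; rewrite massE -(probability_ident P X_ X X_ident 0 [set 0%N]).
  rewrite (_ : [set _ | _] = set0) ?measure0//; apply/seteqP; split => // t /= Xt.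
  by have := X_pos 0%N t; rewrite Xt.
have p_gcd e : (forall x, 0 < p x -> (e %| x)%N) -> (e %| 1)%N.
  move=> pe; apply: X_gcd.2 => x; rewrite /Supp/= -massE lte_fin; exact: pe.
have [M XM] : exists M : R, forall n,
    (\sum_(k < n) P [set t | (k < X t * X t)%N] <= M%:E)%E.
  pose I := (\int[P]_t ((X t * X t)%:R : R)%:E)%E.
  have Ifin : I \is a fin_num.
    rewrite ge0_fin_numE ?integral_ge0//.
    move: X_sq; rewrite unlock; congr (_ < _)%E.
    by apply: eq_integral => t _; rewrite natrM -expr2.
  exists (fine I) => n; rewrite fineK//.
  exact: (sum_tail_le_integral P X (fun x => x * x)%N n).
(* X > k implies X^2 > k, so the second moment bound also makes the tails of X summable. *)
have [L XL] : exists L, forall n,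
    \sum_(j < n) (1 - \sum_(i < (L + j).+1) p i) <= 2^-1.
  apply: (bounded_sum_tail (fun k => 1 - \sum_(i < k.+1) p i) M) => [k|n|].
  - by rewrite subr_ge0.
  - rewrite -lee_fin -sumEFin (le_trans _ (XM n))//; apply: lee_sum => k _.
    rewrite tail_mass le_measure ?inE//.
    + exact: (measurable_discrete P X [set x | (k < x)%N]).
    + exact: (measurable_discrete P X [set x | (k < x * x)%N]).
    + by move=> t /= kX; nia.
  - by rewrite invr_gt0.
have [c c01 [n0 uc]] := renewal_lb p p0 p_ge0 p_le1 L p_gcd XL.
have [C C0 awC] := avoid_weight_inv_square R p c n0 p0 p_ge0 p_le1 c01 uc.
have [G GP] := choice nat_sqrtP.
have aeX : {ae P, forall t, exists N, forall n, (N <= n)%N ->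
    ~ (n < X_ n t * X_ n t)%N}.
  apply: (ae_eventually_not P (fun n => [set t | (n < X_ n t * X_ n t)%N]) M) => [k|n].
    exact: (measurable_discrete P (X_ k) [set x | (k < x * x)%N]).
  rewrite (le_trans _ (XM n))//; apply: lee_sum => k _.
  by rewrite (probability_ident P X_ X X_ident k [set x | (k < x * x)%N]).
pose B m := [set t | all (leq^~ (G m)) (prefix_of P X_ m t) /\
                     no_sum m (prefix_of P X_ m t)].
have aeB : {ae P, forall t, exists N, forall m, (N <= m)%N -> ~ B m t}.
  apply: (ae_eventually_not P B (C * 2)) => [m|n].
    exact: (measurable_prefix P X_ m [set l | all (leq^~ (G m)) l /\ no_sum m l]).
  rewrite (@le_trans _ _ (\sum_(k < n) (C / k.+1%:R ^+ 2))%:E)//; last first.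
    by rewrite lee_fin -mulr_sumr ler_wpM2l// sum_inv_square_le.
  rewrite -sumEFin; apply: lee_sum => m _.
  have := probability_no_sum_prefix P X_ X X_indep X_ident (G m) m m [::].
  rewrite big_nil mul1r => Bm; apply: (@le_trans _ _ (avoid_weight p (G m) m m [::])%:E).
    apply: le_trans Bm; rewrite /B/= add0n le_measure ?inE//.
    + exact: (measurable_prefix P X_ m [set l | all (leq^~ (G m)) l /\ no_sum m l]).
    + exact: (measurable_prefix P X_ m
        [set l | [/\ take 0 l = [::], all (leq^~ (G m)) l & no_sum m l]]).
    + by move=> t /= [? ?]; rewrite take0.
  by rewrite lee_fin awC.
apply: filterS2 aeX aeB => t [N1 XN1] [N2 BN2].
(* The added squares absorb the finitely many early gaps, so that X_i^2 <= m for every i < m. *)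
exists (N2 + \sum_(i < N1) X_ i t * X_ i t)%N => m Nm.
have Xm i : (i < m)%N -> (X_ i t * X_ i t <= m)%N.
  move=> im; have [N1i|iN1] := leqP N1 i.
    by have /negP := XN1 i N1i; rewrite -leqNgt => /leq_trans; apply; exact: ltnW.
  rewrite (leq_trans _ (leq_trans (leq_addl _ _) Nm))//.
  by rewrite (bigD1 (Ordinal iN1))//= leq_addr.
have allG : all (leq^~ (G m)) (prefix_of P X_ m t).
  apply/(all_nthP 0%N) => i; rewrite size_mkseq => im; rewrite nth_mkseq//.
  by have /andP[_] := GP m; have := Xm i im; nia.
(* Without a representation of m, the prefix of length m would lie in the excluded event [B m]. *)
apply: contrapT => no_pair; apply: (BN2 m (leq_trans (leq_addr _ _) Nm)).
split => //; apply/(pairwiseP 0%N) => i j; rewrite !inE size_scanl size_mkseq => im jm ij.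
apply/eqP => mE; apply: no_pair; exists [:: i; j]; split => //=; first by rewrite ij.
by rewrite !big_cons big_nil addn0 -mE !nth_partial_sums_prefix.
Qed.
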